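(* Let $0<p\le\frac34$ and $q\in(0,1)$, and let $\mathbb{Q}$ be the law of the elephant random walk (with parameters $p,q$) conditioned to avoid zero. Then $$\mathbb{Q}(S_0=0)=1,\qquad \mathbb{Q}(S_1=\pm1)=\mathbb{P}(S_1=\pm1),$$ and, for $m\ge1$ and $x\ne0$, $$\mathbb{Q}(S_{m+1}=x\pm1\mid S_m=x)=\frac{m}{m+2p-1}\,\frac{|x\pm1|}{|x|}\,\mathbb{P}(S_{m+1}=x\pm1\mid S_m=x)=\frac{m}{m+2p-1}\,\frac{|x\pm1|}{|x|}\left\{\frac12\pm\left(p-\frac12\right)\frac{x}{m}\right\}.$$
   Context: Elephant random walk (ERW): $S_0=0$, $S_n=X_1+\cdots+X_n$ for $n\ge1$, where $X_1=+1$ with probability $q$ and $X_1=-1$ with probability $1-q$, and for $n\ge 1$, $X_{n+1}=+X_{U_n}$ with probability $p$ and $X_{n+1}=-X_{U_n}$ with probability $1-p$, with $U_n$ uniform on $\{1,\dots,n\}$; all random choices are mutually independent. $\mathbb{P}$ is its law, $\mathbb{P}[\cdot]$ the expectation under $\mathbb{P}$. $T_0:=\inf\{n\ge1: S_n=0\}$. $a_n:=\dfrac{\Gamma(n)}{\Gamma(n+2p-1)}$ for $n\ge1$. $h(0,0):=a_1$ and $h(m,y):=a_m|y|$ for $m>0$, $y\ne0$. The law $\mathbb{Q}$ of the ERW conditioned to avoid zero (C-ERW) is the probability measure on path space determined by $$\mathbb{Q}(A)=\mathbb{P}\left[1_A\frac{h(m,S_m)}{h(0,0)}1_{\{T_0>m\}}\right]\quad\text{for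 all } m\ge0,\ A\in\sigma(S_0,\dots,S_m).$$ It exists because $(h(m,S_m)1_{\{T_0>m\}})_{m\ge0}$ is a $\mathbb{P}$-martingale. The conditional probabilities given $S_m=x$ are understood for integers $x\neq 0$ for which the conditioning event has positive probability. *)

(* Defs.v *)
From HB Require Import structures.
From mathcomp Require Import all_boot all_order all_algebra.
From mathcomp Require Import all_classical all_reals all_analysis.

Set Implicit Arguments.
Unset Strict Implicit.
Unset Printing Implicit Defensive.

Import Order.TTheory GRing.Theory Num.Theory.
Import numFieldNormedType.Exports.

Local Open Scope classical_set_scope.
Local Open Scope ring_scope.

HB.instance Definition _ := isPointed.Build int 0.

HB.instance Definition _ := @isMeasurable.Build default_measure_display
  int discrete_measurable discrete_measurable0
  discrete_measurableC discrete_measurableU.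

(* Path space: integer sequences with the sigma-algebra generated by the
   coordinate maps; s n is the position at time n *)
Definition cylinder : set (set (nat -> int)) :=
  \bigcup_n preimage_set_system setT (fun s : nat -> int => s n) measurable.

Definition path_space := g_sigma_algebraType cylinder.

HB.instance Definition _ := Measurable.on path_space.

(* sigma(S_0, ..., S_m) *)
Definition path_sigma (m : nat) : set (set path_space) :=
  g_sigma_preimage (fun (i : 'I_m.+1) (s : path_space) => s i).

Section independence.
Context d (T : measurableType d) (R : realType) (P : probability T R).
Local Open Scope ereal_scope.

Definition mutually_independent (I : eqType) (G : I -> set (set T)) : Prop :=
  forall (J : seq I) (A : I -> set T), uniq J ->
    (forall i, i \in J -> G i (A i)) ->
    P (\big[setI/setT]_(i <- J) A i) = \prod_(i <- J) P (A i).

End independence.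

(* Meaningful when mu B is positive and finite *)
Definition cond_prob d (T : measurableType d) (R : realType)
    (mu : set T -> \bar R) (A B : set T) : R :=
  fine (mu (A `&` B)) / fine (mu B).

Section elephant_random_walk.
Context d (Omega : measurableType d) (R : realType) (Pr : probability Omega R).

(* The sigma-algebras of the elementary random choices: the first step (None),
   the recalled times U_1, U_2, ... (inl) and the signs eps_1, eps_2, ... (inr) *)
Definition erw_choice (X : nat -> {RV Pr >-> int}) (U : nat -> {RV Pr >-> nat})
    (eps : nat -> {RV Pr >-> bool}) (i : option (nat + nat)) :
    set (set Omega) :=
  match i with
  | None => preimage_set_system setT (X 1%N) measurable
  | Some (inl n) => preimage_set_system setT (U n.+1) measurable
  | Some (inr n) => preimage_set_system setT (eps n.+1) measurable
  end.

(* X n, U n, eps n are only relevant for n >= 1; eps n is true when the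
   recalled step is repeated and false when it is reversed *)
Record is_erw (p q : R) (X : nat -> {RV Pr >-> int})
    (U : nat -> {RV Pr >-> nat}) (eps : nat -> {RV Pr >-> bool}) : Prop := {
  erw_first_pos : Pr [set w | X 1%N w = 1] = q%:E;
  erw_first_neg : Pr [set w | X 1%N w = -1] = (1 - q)%:E;
  erw_recall : forall n k : nat, (1 <= k <= n)%N ->
    Pr [set w | U n w = k] = (n%:R^-1)%:E;
  erw_repeat : forall n : nat, (1 <= n)%N ->
    Pr [set w | eps n w = true] = p%:E;
  erw_reverse : forall n : nat, (1 <= n)%N ->
    Pr [set w | eps n w = false] = (1 - p)%:E;
  erw_step : forall (n : nat) (w : Omega), (1 <= n)%N ->
    X n.+1 w = if eps n w then X (U n w) w else - X (U n w) w;
  erw_indep : mutually_independent Pr (erw_choice X U eps)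
}.

Definition walk (X : nat -> {RV Pr >-> int}) (w : Omega) : path_space :=
  fun n => \sum_(1 <= i < n.+1) X i w.

Lemma measurable_addz (f g : Omega -> int) :
  measurable_fun setT f -> measurable_fun setT g ->
  measurable_fun setT (fun w => f w + g w).
Proof.
move=> mf mg _ B _; rewrite setTI.
pose F (k : int) := f @^-1` [set k] `&` g @^-1` [set j | B (k + j)].
have -> : (fun w => f w + g w) @^-1` B =
    \bigcup_n oapp F set0 (unpickle n).
  apply/seteqP; split=> [w Bw|w [n _]].
    by exists (pickle (f w)) => //; rewrite pickleK.
  by case: unpickle => [k|] //= [<-].
apply: bigcupT_measurable => n; case: unpickle => [k|] /=; last first.
  exact: measurable0.
rewrite /F; apply: measurableI; rewrite -[X in measurable X]setTI.
- exact: mf.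
- exact: mg.
Qed.

Lemma measurable_walk (X : nat -> {RV Pr >-> int}) :
  measurable_fun setT (walk X).
Proof.
have mS n : measurable_fun setT (fun w => walk X w n).
  rewrite /walk; elim: n => [|n IH].
    by under eq_fun do rewrite big_geq//; exact: measurable_cst.
  under eq_fun do rewrite big_nat_recr//=.
  exact: measurable_addz.
apply: (@measurability _ _ Omega path_space setT (walk X) cylinder) => //.
move=> _ [_ [n _ [B mB <-]] <-].
by rewrite !setTI; have := mS n measurableT _ mB; rewrite setTI.
Qed.

HB.instance Definition _ (X : nat -> {RV Pr >-> int}) :=
  isMeasurableFun.Build _ _ _ _ (walk X) (measurable_walk X).

End elephant_random_walk.

Section conditioned_walk.
Context (R : realType).

(* Euler's Gamma function on the positive reals *)
Definition Gamma (x : R) : R :=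
  \int[lebesgue_measure]_(t in `]0, +oo[) (t `^ (x - 1) * expR (- t)).

Definition erw_a (p : R) (n : nat) : R := Gamma n%:R / Gamma (n%:R + 2 * p - 1).

(* Used only at (0, 0) and at (m, y) with m > 0 *)
Definition erw_h (p : R) (m : nat) (y : int) : R :=
  if (m == 0)%N then erw_a p 1 else erw_a p m * `|y|%:~R.

(* T_0 takes the value +oo on paths that never return to 0 *)
Definition T0 (s : path_space) : \bar R :=
  ereal_inf [set n%:R%:E | n in [set n : nat | (1 <= n)%N /\ s n = 0]].

Definition is_cerw (p : R) (P Q : probability path_space R) : Prop :=
  forall (m : nat) (A : set path_space), path_sigma m A ->
    Q A = 'E_P[fun s => (\1_A s * (erw_h p m (s m) / erw_h p 0 0)
                        * \1_[set s' | (m%:R%:E < T0 s')%E] s)%R]%E.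

End conditioned_walk.

(* Main.v *)
Require Import Defs.
From HB Require Import structures.
From mathcomp Require Import all_boot all_order all_algebra.
From mathcomp Require Import all_classical all_reals all_analysis.
From mathcomp Require Import measurable_realfun exponential_distribution.
From mathcomp Require Import ring lra zify.

Set Implicit Arguments.
Unset Strict Implicit.
Unset Printing Implicit Defensive.

Import Order.TTheory GRing.Theory Num.Theory.
Import numFieldNormedType.Exports.

Local Open Scope classical_set_scope.
Local Open Scope ring_scope.

(** The law of the conditioned walk is a Doob transform of the law of the
    elephant random walk, killed at its first return to 0, by the function
    [erw_h].  On an event [A] known at time m that is contained in the event
    that the path is at [x] at time m, the density of [Q] is a constant on the
    paths that have avoided 0, so that
      Q A = h(m, x) / h(0, 0) * P (A, no visit to 0 up to time m)   ([cerwE]).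
    The values at times 0 and 1 are the cases m = 0, 1.  For the transition
    probabilities this formula is used at the times m and m+1:

    - the position chain is Markov under [P], also on the event that 0 has been
      avoided ([walk_markov]), with transition probabilities
      t = 1/2 + e (p - 1/2) x / m, whence
        Q (S_m = x, S_(m+1) = x + e) =
          h(m+1, x+e) / h(0, 0) * t * P (S_m = x, no visit to 0);
      for x + e = 0 both sides vanish because h does;

    - dividing by Q (S_m = x) leaves t * h(m+1, x+e) / h(m, x), provided that
      P (S_m = x, no visit to 0) is positive.  It is: any sequence of signs is a
      possible sequence of steps, so the steps of a path that reaches x can be
      rearranged with those in the direction of x first, and the rearranged path
      stays on the side of x ([walk_avoids_gt0]);

    - a_(m+1) / a_m = m / (m + 2p - 1) by the functional equation of the Gamma
      function ([GammaS], [erw_aS]), which is proved by integration by parts.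

    The Markov property comes from the joint law of the steps ([history_law]):
    given the first n steps, the recalled time and the sign are independent of
    them, so that the next step equals e with a probability that only depends on
    how many of these steps equal e and how many equal -e; for steps 1 and -1
    these two numbers are determined by n and by the position. *)

(** * Euler's Gamma function *)

Section gamma.
Context {R : realType}.
Notation mu := lebesgue_measure.
Implicit Types x a b : R.

Definition Gamma_integrand x (t : R) : R := t `^ (x - 1) * expR (- t).

Lemma Gamma_integrand_ge0 x t : 0 <= Gamma_integrand x t.
Proof. by rewrite mulr_ge0 ?powR_ge0 ?expR_ge0. Qed.

Lemma Gamma_integrand_gt0 x t : 0 < t -> 0 < Gamma_integrand x t.
Proof. by move=> t0; rewrite mulr_gt0 ?powR_gt0 ?expR_gt0. Qed.

Lemma measurable_Gamma_integrand x (D : set R) :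
  measurable_fun D (EFin \o Gamma_integrand x).
Proof.
apply: measurable_funTS; apply/measurable_EFinP; apply: measurable_funM.
  exact: measurable_powR.
by apply: measurableT_comp => //; exact: measurable_expR.
Qed.

(** The boundary terms are kept: they vanish only when the segment exhausts the
    half line. *)
Lemma Gamma_by_parts x a b : 0 <= x -> 0 < a -> a < b ->
  (x%:E * \int[mu]_(t in `[a, b]) (Gamma_integrand x t)%:E =
   \int[mu]_(t in `[a, b]) (Gamma_integrand (x + 1) t)%:E +
   (Gamma_integrand (x + 1) b - Gamma_integrand (x + 1) a)%:E)%E.
Proof.
move=> x_ge0 a0 ab.
have cpow y t : 0 < t -> {for t, continuous (fun u : R => u `^ y)}.
  move=> t0; apply: differentiable_continuous; apply/derivable1_diffP.
  by apply: derivable_powR; rewrite in_itv/= t0.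
have cexp (t : R) : {for t, continuous (fun u : R => expR (- u))}.
  by apply: continuous_comp; [exact: continuousN | exact: continuous_expR].
have dexp (t : R) : is_derive t 1 (fun u : R => - expR (- u)) (expR (- t)).
  by apply: is_derive_eq; rewrite /GRing.scale/=; ring.
have itv0 t : a <= t -> 0 < t by exact: lt_le_trans.
have Gi1 t : Gamma_integrand (x + 1) t = t `^ x * expR (- t).
  by rewrite /Gamma_integrand addrK.
under [X in (_ = X + _)%E]eq_integral do rewrite Gi1.
have := @integration_by_parts R (fun t => t `^ x) (fun t => - expR (- t))
  (fun t => x * t `^ (x - 1)) (fun t => expR (- t)) a b ab.
move=> ->//; last first.
- move=> t _; rewrite derive1E; exact: derive_val.
- split.
  + by move=> t _; apply: ex_derive.
  + by apply: cvg_at_right_filter; apply: cvgN; exact: cexp.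
  + by apply: cvg_at_left_filter; apply: cvgN; exact: cexp.
- by apply: continuous_subspaceT => t; exact: cexp.
- move=> t; rewrite in_itv/= => /andP[at_ _].
  by rewrite powR_derive1// in_itv/= (lt_trans a0).
- split.
  + move=> t; rewrite in_itv/= => /andP[at_ _].
    by apply: derivable_powR; rewrite in_itv/= (lt_trans a0).
  + by apply: cvg_at_right_filter; exact: cpow.
  + by apply: cvg_at_left_filter; apply: cpow; exact: lt_trans ab.
- apply: continuous_in_subspaceT => t; rewrite inE/= in_itv/= => /andP[/itv0 t0 _].
  by apply: cvgM; [exact: cvg_cst | exact: cpow].
rewrite -ge0_integralZl_EFin//; last 2 first.
- by move=> t _; rewrite lee_fin Gamma_integrand_ge0.
- exact: measurable_Gamma_integrand.
under [X in (_ = _ - X + _)%E]eq_integral do rewrite mulrN EFinN -mulrA EFinM.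
rewrite integral_ge0N; last first.
  by move=> t _; rewrite -EFinM lee_fin mulr_ge0// Gamma_integrand_ge0.
rewrite oppeK addeAC -EFinD !Gi1 !mulrN.
have cancel (u v : R) : - u - - v + (u - v) = 0 by ring.
rewrite cancel add0e.
by apply: eq_integral.
Qed.

Lemma Gamma_integrand_cvg0 x : 0 < x ->
  Gamma_integrand (x + 1) t @[t --> 0^'+] --> 0.
Proof.
move=> x0; apply: (@squeeze_cvgr _ _ _ _ (fun=> 0) (fun t => t `^ x)).
- near=> t; rewrite Gamma_integrand_ge0/= /Gamma_integrand addrK.
  rewrite ler_piMr ?powR_ge0// -expR0 ler_expR oppr_le0.
  by near: t; exact: nbhs_right_ge.
- exact: cvg_cst.
- exact: powR_cvg0.
Unshelve. all: by end_near. Qed.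

Lemma Gamma_integrand_cvgy0 x : 0 <= x ->
  Gamma_integrand (x + 1) t @[t --> +oo] --> 0.
Proof.
move=> x_ge0; have [k xk] : exists k : nat, x <= k%:R.
  by exists (Num.Def.truncn x).+1; rewrite ltW// truncnS_gt.
apply: (@squeeze_cvgr _ _ _ _ (fun=> 0) (fun t => k.+1`!%:R * t^-1)).
- (* [k] was chosen with x <= k; the term of order k.+1 of the exponential
     series beats the power by a factor t. *)
  near=> t.
  have t1 : 1 <= t by near: t; apply: nbhs_pinfty_ge; exact: num_real.
  have t0 : 0 < t by exact: lt_le_trans t1.
  rewrite Gamma_integrand_ge0/= /Gamma_integrand addrK.
  rewrite expRN ler_pdivrMr ?expR_gt0// mulrAC ler_pdivlMr//.
  apply: (@le_trans _ _ (t ^+ k.+1)).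
    rewrite exprSr ler_pM2r//.
    have : t `^ x <= t `^ k%:R by rewrite ler_powR.
    by rewrite powR_mulrn// ltW.
  rewrite mulrC -ler_pdivrMr ?ltr0n ?fact_gt0//.
  by rewrite (le_trans _ (expR_ge1Dxn k (ltW t0)))// lerDr.
- exact: cvg_cst.
- rewrite -[X in _ --> X](mulr0 k.+1`!%:R); apply: cvgM; first exact: cvg_cst.
  apply/(@gtr0_cvgV0 R R (pinfty_nbhs R) _ id); last exact: cvg_id.
  by near=> t; near: t; exact: nbhs_pinfty_gt.
Unshelve. all: by end_near. Qed.

(** The extended real integral behind [Gamma]: the functional equation holds for
    it without knowing that it converges, and convergence is then deduced from
    the functional equation. *)
Definition Gamma_integral x :=
  (\int[mu]_(t in `]0%R, +oo[) (Gamma_integrand x t)%:E)%E.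

Let seg n : set R := `[n.+1%:R^-1, n.+2%:R]%classic.

Let bigcup_seg : \bigcup_n seg n = `]0, +oo[%classic.
Proof.
apply/seteqP; split=> [t [n _]|t].
  rewrite /seg /= !in_itv/= andbT => /andP[+ _]; apply: lt_le_trans.
  by rewrite invr_gt0.
rewrite /= in_itv/= andbT => t0.
exists (maxn (Num.Def.truncn t) (Num.Def.truncn t^-1)) => //.
rewrite /seg /= in_itv/=; apply/andP; split.
  rewrite invf_ple ?posrE//; apply: (le_trans (ltW (truncnS_gt _))).
  by rewrite ler_nat ltnS leq_maxr.
apply: (le_trans (ltW (truncnS_gt _))).
by rewrite ler_nat leqW// ltnS leq_maxl.
Qed.

Let cvg_seg x :
  (\int[mu]_(t in seg n) (Gamma_integrand x t)%:E @[n --> \oo] -->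
   Gamma_integral x)%E.
Proof.
rewrite /Gamma_integral -bigcup_seg; apply: ge0_nondecreasing_set_cvg_integral.
- move=> m n mn; rewrite subsetEset; apply: subset_itv; rewrite bnd_simp.
    by rewrite lef_pV2 ?posrE// ler_nat.
  by rewrite ler_nat.
- by move=> n; exact: measurable_itv.
- by move=> n; exact: measurable_Gamma_integrand.
- by move=> n t _; rewrite lee_fin Gamma_integrand_ge0.
Qed.

(** Integration by parts on segments that increase to the open half line; the
    integrals converge monotonically, and the boundary terms tend to 0. *)
Lemma Gamma_integralS x : 0 < x ->
  (Gamma_integral (x + 1) = x%:E * Gamma_integral x)%E.
Proof.
move=> x0; have xfin : x%:E \is a fin_num by [].
have := cvgeZl xfin (@cvg_seg x).
rewrite (_ : (fun n => _) = (fun n =>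
    \int[mu]_(t in seg n) (Gamma_integrand (x + 1) t)%:E +
    (Gamma_integrand (x + 1) n.+2%:R - Gamma_integrand (x + 1) n.+1%:R^-1)%:E)%E);
    last first.
  apply/funext => n; rewrite Gamma_by_parts//; first exact: ltW.
  by rewrite (@le_lt_trans _ _ 1)// ?invf_le1// ?ler1n// ltr1n.
move=> xcvg; rewrite -(cvg_lim _ xcvg)//; apply/esym/cvg_lim => //.
rewrite -[Gamma_integral (x + 1)]adde0; apply: cvgeD; first by rewrite fin_num_adde_defl.
  exact: cvg_seg.
apply: cvg_EFin; first by near=> n.
rewrite -[X in _ --> X](subr0 0); apply: cvgB => /=.
  move/cvg_pinftyP : (Gamma_integrand_cvgy0 (ltW x0)); apply.
  apply/cvgrnyP; rewrite [X in X @ _](_ : _ = (fun n => n + 2)%N).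
    exact: cvg_addnr.
  by apply/funext => n; rewrite addn2.
move/cvg_at_rightP : (Gamma_integrand_cvg0 x0); apply; split => //.
exact: cvg_harmonic.
Unshelve. all: by end_near. Qed.

(** An integral of a nonnegative function vanishes only if the function does
    almost everywhere, but here the integrand never vanishes. *)
Lemma Gamma_integral_gt0 x : (0 < Gamma_integral x)%E.
Proof.
rewrite lt0e; apply/andP; split; last first.
  by apply: integral_ge0 => t _; rewrite lee_fin Gamma_integrand_ge0.
apply/eqP => I0.
have : (\int[mu]_(t in `]0%R, +oo[) `|(Gamma_integrand x t)%:E| = 0)%E.
  rewrite -[RHS]I0; apply: eq_integral => t _.
  by rewrite gee0_abs// lee_fin Gamma_integrand_ge0.
move/ae_eq_integral_abs => /(_ _ _)/wrap[//||].
  exact: measurable_Gamma_integrand.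
move=> [N [mN N0 sub]].
have : (mu `]0%R, +oo[%classic <= 0 :> \bar R)%E.
  rewrite -N0; apply: le_measure; rewrite ?inE//.
  move=> t t0; apply: sub => /= /(_ t0)[]; apply/eqP.
  by rewrite gt_eqF// Gamma_integrand_gt0//; move: t0; rewrite /= in_itv/= andbT.
by rewrite lebesgue_measure_itv/= ltry.
Qed.

(** For x in [1, 2] the integrand is at most [2 * expR (- t / 2)], because the
    power is then at most 1 + t; the functional equation extends convergence
    downwards to x in (0, 1) and upwards to all larger x. *)
Lemma Gamma_integral_lty x : 0 < x -> (Gamma_integral x < +oo)%E.
Proof.
have base y : 1 <= y -> y <= 2 -> (Gamma_integral y < +oo)%E.
  move=> y1 y2.
  apply: (@le_lt_trans _ _ (\int[mu]_(t in `]0%R, +oo[)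
      (4%:E * (exponential_pdf 2^-1 t)%:E)))%E.
    apply: ge0_le_integral => //.
    - by move=> t _; rewrite lee_fin Gamma_integrand_ge0.
    - exact: measurable_Gamma_integrand.
    - apply: measurable_funeM; apply/measurable_EFinP; apply: measurable_funTS.
      exact: measurable_exponential_pdf.
    - move=> t; rewrite /= in_itv/= andbT => t0.
      rewrite -EFinM lee_fin exponential_pdfE ?(ltW t0)// mulrA /Gamma_integrand.
      have -> : - t = - 2^-1 * t + - 2^-1 * t by field.
      rewrite expRD mulrA ler_pM2r ?expR_gt0//.
      rewrite mulNr expRN ler_pdivrMr ?expR_gt0//.
      have h1 := expR_ge1Dx (2^-1 * t).
      apply: (@le_trans _ _ (1 + t)); last by lra.
      have [t1|/ltW t1] := leP t 1.
        have : t `^ (y - 1) <= t `^ 0 by rewrite ger_powR ?t0// subr_ge0.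
        by rewrite powRr0 => /le_trans; apply; rewrite lerDl ltW.
      have : t `^ (y - 1) <= t `^ 1 by rewrite ler_powR//; lra.
      by rewrite powRr1 ?(ltW t0)// => /le_trans; apply; rewrite lerDr.
  rewrite ge0_integralZl//=; last 2 first.
  - apply/measurable_EFinP; apply: measurable_funTS.
    exact: measurable_exponential_pdf.
  - by move=> t _; rewrite lee_fin exponential_pdf_ge0.
  apply: lte_mul_pinfty => //.
  apply: (@le_lt_trans _ _ (\int[mu]_t (exponential_pdf 2^-1 t)%:E))%E.
    apply: ge0_subset_integral => //.
      by apply/measurable_EFinP; exact: measurable_exponential_pdf.
    by move=> t _; rewrite lee_fin exponential_pdf_ge0.
  by rewrite integral_exponential_pdf ?ltry// invr_gt0.
move=> x0.
have fin1 y : 0 < y -> (Gamma_integral (y + 1) < +oo)%E ->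
    (Gamma_integral y < +oo)%E.
  move=> y0; rewrite Gamma_integralS//.
  rewrite !ltey; apply: contraNN => /eqP ->.
  by rewrite gt0_muley ?lte_fin.
suff up (n : nat) y : 0 < y -> y <= n%:R -> (Gamma_integral y < +oo)%E.
  by apply: (up (Num.Def.truncn x).+1) => //; rewrite ltW// truncnS_gt.
elim: n y => [|n IH] y y0 yn; first by move: (lt_le_trans y0 yn); rewrite ltxx.
have [y1|/ltW y1] := leP y 1.
  by apply: fin1 => //; apply: base; lra.
have [y2|y2] := leP y 2; first exact: base.
have -> : y = (y - 1) + 1 by ring.
rewrite Gamma_integralS; last lra.
apply: lte_mul_pinfty => //; first by rewrite lee_fin; lra.
by apply: IH; [lra | rewrite lerBlDr natr1].
Qed.

Lemma GammaE x : 0 < x -> (Gamma x)%:E = Gamma_integral x.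
Proof.
move=> x0; rewrite /Gamma /Rintegral fineK//.
by rewrite ge0_fin_numE ?Gamma_integral_lty// ltW// Gamma_integral_gt0.
Qed.

Lemma Gamma_gt0 x : 0 < x -> 0 < Gamma x.
Proof. by move=> x0; rewrite -lte_fin GammaE// Gamma_integral_gt0. Qed.

Lemma GammaS x : 0 < x -> Gamma (x + 1) = x * Gamma x.
Proof.
move=> x0; apply: EFin_inj; rewrite EFinM !GammaE// ?Gamma_integralS//.
by rewrite addr_gt0.
Qed.

End gamma.

(** * The normalising sequence *)

Lemma erw_a_gt0 (R : realType) (p : R) n : 0 < p -> (0 < n)%N -> 0 < erw_a p n.
Proof.
move=> p_gt0 n0; have n1 : 1 <= n%:R :> R by rewrite ler1n.
have npos : 0 < n%:R + 2 * p - 1 by lra.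
by rewrite /erw_a divr_gt0 ?Gamma_gt0 ?ltr0n.
Qed.

Lemma erw_aS (R : realType) (p : R) n : 0 < p -> (0 < n)%N ->
  erw_a p n.+1 = n%:R / (n%:R + 2 * p - 1) * erw_a p n.
Proof.
move=> p_gt0 n0; have n1 : 1 <= n%:R :> R by rewrite ler1n.
have npos : 0 < n%:R + 2 * p - 1 by lra.
rewrite /erw_a -natr1 GammaS; last by lra.
rewrite (_ : n%:R + 1 + 2 * p - 1 = n%:R + 2 * p - 1 + 1); last by ring.
rewrite GammaS//; field.
by rewrite !gt_eqF// Gamma_gt0.
Qed.

(** * Conditioning on countably many values *)

Section discrete_conditioning.
Context d (Omega : measurableType d) (R : realType).
Local Open Scope ereal_scope.

Lemma measurable_countable_preimage (T : countType) (Z : Omega -> T) (B : set T) :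
  (forall z, measurable [set w | Z w = z]) -> measurable (Z @^-1` B).
Proof.
move=> mZ.
rewrite (_ : _ @^-1` _ =
    \bigcup_n oapp (fun z => [set w | Z w = z /\ B z]) set0 (unpickle n)).
  apply: bigcupT_measurable => n; case: unpickle => [z|] /=; last exact: measurable0.
  have [Bz|nBz] := pselect (B z).
    by rewrite (_ : [set _ | _] = [set w | Z w = z])//; apply/seteqP; split => w //= [].
  by rewrite (_ : [set _ | _] = set0)//; apply/seteqP; split => w //= [].
apply/seteqP; split=> [w Bw|w [n _]].
  by exists (pickle (Z w)) => //; rewrite pickleK.
by case: unpickle => [z|]//= [<-].
Qed.

(** Summation over the atoms of a countable partition.  For [A] contained in [B]:
    if the conditional probability of [A] given [B] is [c] on every atom, then it
    is [c]. *)
Lemma probability_proportional (P : probability Omega R)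
    (T : countType) (Z : Omega -> T) (A B : set Omega) (c : R) :
  (forall z, measurable [set w | Z w = z]) -> measurable A -> measurable B ->
  (forall z, P (A `&` [set w | Z w = z]) = c%:E * P (B `&` [set w | Z w = z])) ->
  P A = c%:E * P B.
Proof.
move=> mZ mA mB AB.
pose fib n := [set w | pickle (Z w) = n].
have mfib n : measurable (fib n) by exact: (@measurable_countable_preimage _ Z [set z | pickle z = n]).
have sumE C : measurable C -> P C = \sum_(n <oo) P (C `&` fib n).
  move=> mC; rewrite -measure_semi_bigcup; last first.
  - by apply: bigcupT_measurable => n; exact: measurableI.
  - by move=> i j _ _ [w [[_ <-] [_ <-]]].
  - by move=> n; exact: measurableI.
  rewrite -setI_bigcupr; congr (P _); rewrite -[LHS]setIT; congr (_ `&` _).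
  by apply/seteqP; split => // w _; exists (pickle (Z w)).
rewrite (sumE A)// (sumE B)// -nneseriesZl//.
apply: eq_eseriesr => n _.
have [[z zn]|nz] := pselect (exists z : T, pickle z = n).
  rewrite (_ : fib n = [set w | Z w = z])//; apply/seteqP; split => w /=.
    by rewrite /fib/= -zn => /(pcan_inj pickleK).
  by rewrite /fib/= => ->.
rewrite (_ : fib n = set0) ?setI0 ?measure0 ?mule0//.
by apply/seteqP; split => w //= wn; apply: nz; exists (Z w).
Qed.

Lemma probability_in_seq (P : probability Omega R) (T : eqType)
    (Z : Omega -> T) (s : seq T) (A : set Omega) :
  (forall z, measurable [set w | Z w = z]) -> measurable A -> uniq s ->
  measurable (A `&` [set w | Z w \in s]) /\
  P (A `&` [set w | Z w \in s]) = \sum_(z <- s) P (A `&` [set w | Z w = z]).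
Proof.
move=> mZ mA; elim: s => [_|z s IH /= /andP[zs us]].
  rewrite big_nil (_ : [set w | Z w \in [::]] = set0) ?setI0 ?measure0//.
  by apply/seteqP; split.
have [ms sE] := IH us.
have E : A `&` [set w | Z w \in z :: s] =
    (A `&` [set w | Z w = z]) `|` (A `&` [set w | Z w \in s]).
  rewrite -setIUr; congr (_ `&` _); apply/seteqP; split => w /=; rewrite inE.
    by case/predU1P; [left|right].
  by case=> [->|->]; rewrite ?eqxx ?orbT.
have mz : measurable (A `&` [set w | Z w = z]) by exact: measurableI.
split; first by rewrite E; exact: measurableU.
rewrite E big_cons measureU//; first by rewrite -[in RHS]sE.
apply/seteqP; split=> w //= [[_ Zz] [_ Zs]].
by move: zs; rewrite -Zz Zs.
Qed.

(** The values outside [s], on which [Z] may differ from all the listed ones,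
    carry no mass. *)
Lemma probability_total (P : probability Omega R) (T : eqType)
    (Z : Omega -> T) (s : seq T) (A : set Omega) :
  (forall z, measurable [set w | Z w = z]) -> measurable A -> uniq s ->
  \sum_(z <- s) P [set w | Z w = z] = 1 ->
  P A = \sum_(z <- s) P (A `&` [set w | Z w = z]).
Proof.
move=> mZ mA us s1.
have [mAs <-] := probability_in_seq P mZ mA us.
have [] := probability_in_seq P mZ measurableT us.
rewrite setTI; under eq_bigr do rewrite setTI.
rewrite s1; set D := [set w | _] => mD PD.
rewrite (measureDI P mA mD) [X in X + _](_ : _ = 0) ?add0e//.
apply/eqP; rewrite -measure_le0 (@le_trans _ _ (P (~` D)))//.
  rewrite le_measure// ?inE//; first exact: measurableD.
  exact: measurableC.
by rewrite probability_setC// PD subee.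
Qed.

End discrete_conditioning.

(** * Path space and the conditioned law *)

Section path_space_events.
Implicit Types (m k : nat) (s : path_space).

Lemma measurable_coordinate k (B : set int) :
  measurable [set s : path_space | B (s k)].
Proof.
apply: sub_sigma_algebra; exists k => //; exists B => //.
by rewrite setTI.
Qed.

Definition avoids m s : bool := all (fun k => s k != 0) (iota 1 m).

Lemma avoidsS m s : avoids m.+1 s = avoids m s && (s m.+1 != 0).
Proof. by rewrite /avoids -[X in iota _ X]addn1 iotaD all_cat /= andbT add1n. Qed.

Lemma eq_avoids m s s' : (forall k, (k <= m)%N -> s k = s' k) ->
  avoids m s -> avoids m s'.
Proof.
move=> ss' /allP av; apply/allP => k km; rewrite -ss' ?av//.
by move: km; rewrite mem_iota => /andP[].
Qed.

Lemma measurable_avoids m : measurable [set s | avoids m s].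
Proof.
elim: m => [|m IH].
  by rewrite (_ : mkset _ = setT)//; apply/seteqP; split.
rewrite (_ : mkset _ = [set s | avoids m s] `&` [set s | s m.+1 != 0]).
  by apply: measurableI => //; exact: (measurable_coordinate m.+1 [set x | x != 0]).
by apply/seteqP; split => s /=; rewrite avoidsS => /andP.
Qed.

Lemma lt_T0 (R : realType) m s : (m%:R%:E < T0 R s)%E = avoids m s.
Proof.
apply/idP/allP => [mT k|av].
  rewrite mem_iota add1n ltnS => /andP[k0 km]; apply/eqP => sk; move: mT.
  apply/negP; rewrite -leNgt; apply: (@le_trans _ _ k%:R%:E).
    by apply: ereal_inf_lbound; exists k.
  by rewrite lee_fin ler_nat.
apply: (@lt_le_trans _ _ m.+1%:R%:E); first by rewrite lte_fin ltr_nat.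
apply: le_ereal_inf_tmp => _ [k [k0 sk] <-].
rewrite lee_fin ler_nat ltnNge; apply/negP => km.
by have := av k; rewrite mem_iota k0 add1n ltnS km sk eqxx => /(_ isT).
Qed.

Lemma path_sigma_coordinate m k (B : set int) : (k <= m)%N ->
  path_sigma m [set s | B (s k)].
Proof.
rewrite -ltnS => km; apply: sub_sigma_algebra.
rewrite (bigD1 (Ordinal km))//=; left; exists B => //.
by rewrite setTI.
Qed.

Lemma path_sigmaI m (A B : set path_space) :
  path_sigma m A -> path_sigma m B -> path_sigma m (A `&` B).
Proof.
set G := \big[setU/set0]_(i < m.+1)
  preimage_set_system setT (fun s : path_space => s i) measurable.
exact: (@measurableI _ (g_sigma_algebraType G)).
Qed.

Lemma measurable_path_sigma m (A : set path_space) :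
  path_sigma m A -> measurable A.
Proof.
apply: smallest_sub; first exact: sigma_algebra_measurable.
elim/big_ind : _ => [B []|G H GP HP B [/GP|/HP]//|i _ _ [B _ <-]].
by rewrite setTI; exact: measurable_coordinate.
Qed.

End path_space_events.

Section conditioned_law.
Context (R : realType) (p : R) (P Q : probability path_space R).
Hypothesis cerwQ : is_cerw p P Q.

(** The density vanishes on the paths that have visited 0 and is constant on the
    rest of [A]. *)
Lemma cerwE m (x : int) (A : set path_space) : path_sigma m A ->
  A `<=` [set s | s m = x] -> 0 <= erw_h p m x / erw_h p 0 0 ->
  Q A = ((erw_h p m x / erw_h p 0 0)%:E * P (A `&` [set s | avoids m s]))%E.
Proof.
move=> sA Ax h0; have mA := measurable_path_sigma sA.
have mAa : measurable (A `&` [set s | avoids m s]).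
  by apply: measurableI => //; exact: measurable_avoids.
rewrite (cerwQ sA) unlock.
under eq_integral => s _.
  rewrite (_ : \1_A s * _ * _ = (erw_h p m x / erw_h p 0 0) *
      \1_(A `&` [set s | avoids m s]) s); last first.
    rewrite !indicE in_setI; case: (boolP (s \in A)) => [/set_mem As|_].
      have -> : s m = x := Ax _ As.
      rewrite mul1r; congr (_ * (nat_of_bool _)%:R).
      by apply/idP/idP => /set_mem /= sm; apply/mem_set; move: sm; rewrite /= lt_T0.
    by rewrite !mul0r mulr0.
  rewrite EFinM; over.
rewrite ge0_integralZl_EFin//; first by rewrite integral_indic// setIT.
by apply/measurable_EFinP; exact: measurable_indic.
Qed.

End conditioned_law.

(** * Probabilities of finite sequences of steps *)

Section path_weight.
Context {R : realType} (p q : R).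
Implicit Types (a : seq int) (e : int).

(** The probability that a step [e] follows the steps [a]: each earlier step is
    recalled with the same probability, and is repeated or reversed. *)
Definition step_weight a e : R :=
  (p * (count_mem e a)%:R + (1 - p) * (count_mem (- e) a)%:R) / (size a)%:R.

Definition first_weight e : R :=
  if e == 1 then q else if e == -1 then 1 - q else 0.

(** Lists of steps have the latest step at their head. *)
Fixpoint path_weight a : R :=
  match a with
  | [::] => 1
  | [:: e] => first_weight e
  | e :: a' => path_weight a' * step_weight a' e
  end.

Definition sign_seq a := all [pred x : int | (x == 1) || (x == -1)] a.

Lemma sign_seq_cons e a :
  sign_seq (e :: a) = ((e == 1) || (e == -1)) && sign_seq a.
Proof. by []. Qed.

Lemma path_weight_cons e a : a != [::] ->
  path_weight (e :: a) = path_weight a * step_weight a e.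
Proof. by case: a. Qed.

(** A step of nonzero weight is, up to sign, one of the earlier ones. *)
Lemma sign_seq_weight a : path_weight a != 0 -> sign_seq a.
Proof.
elim: a => // e [|e' a] IH.
  rewrite /= /first_weight; case: (e =P 1) => //= _; case: (e =P -1) => //= _.
  by rewrite eqxx.
rewrite path_weight_cons// mulf_eq0 negb_or => /andP[/IH sa].
rewrite sign_seq_cons sa andbT => w0.
have : (e \in e' :: a) || (- e \in e' :: a).
  apply: contraNT w0; rewrite negb_or => /andP[/count_memPn e0 /count_memPn Ne0].
  by rewrite /step_weight e0 Ne0 !mulr0 addr0 mul0r.
case/orP => /(allP sa)/= /orP[]/eqP E; last 2 first.
- by rewrite -[e]opprK E eqxx orbT.
- by rewrite -[e]opprK E.
- by rewrite E.
by rewrite E eqxx orbT.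
Qed.

(** The position and the length determine the numbers of steps up and down. *)
Lemma sign_seq_count a e : (e == 1) || (e == -1) -> sign_seq a ->
  (count_mem e a + count_mem (- e) a = size a)%N /\
  (count_mem e a)%:Z - (count_mem (- e) a)%:Z = e * \sum_(x <- a) x.
Proof.
move=> se; elim: a => [|x a IH] /=; first by rewrite big_nil mulr0.
move=> /andP[sx /IH [<- sE]]; rewrite big_cons mulrDr -sE !PoszD.
by case/orP: se => /eqP ->; case/orP: sx => /eqP ->; split => //=; lia.
Qed.

Lemma step_weight_sign a e : (e == 1) || (e == -1) -> sign_seq a -> a != [::] ->
  step_weight a e =
  1 / 2 + e%:~R * ((p - 1 / 2) * ((\sum_(x <- a) x)%:~R / (size a)%:R)).
Proof.
move=> se sa; rewrite -size_eq0 => a0.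
have [sz df] := sign_seq_count se sa.
have sz' : (count_mem e a)%:R + (count_mem (- e) a)%:R = (size a)%:R :> R.
  by rewrite -natrD sz.
have df' : (count_mem e a)%:R - (count_mem (- e) a)%:R =
    e%:~R * (\sum_(x <- a) x)%:~R :> R.
  by rewrite -intrM -df rmorphB /= !pmulrn.
have n0 : (size a)%:R != 0 :> R by rewrite pnatr_eq0.
rewrite /step_weight; apply: (mulIf n0); rewrite divfK//.
transitivity ((size a)%:R / 2 + (p - 1 / 2) * (e%:~R * (\sum_(x <- a) x)%:~R)).
  by rewrite -df' -sz'; field.
by field.
Qed.

Hypotheses (p_gt0 : 0 < p) (p_lt1 : p < 1) (q_gt0 : 0 < q) (q_lt1 : q < 1).

(** Whatever step is recalled, it can be repeated or reversed, so both signs are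
    possible next. *)
Lemma path_weight_gt0 a : sign_seq a -> 0 < path_weight a.
Proof.
elim: a => // e [_ /= | e' a IH].
  rewrite andbT /first_weight; case: eqP => // _ /eqP->.
  by rewrite eqxx subr_gt0.
rewrite path_weight_cons// sign_seq_cons => /andP[se sa].
rewrite mulr_gt0 ?IH// divr_gt0 ?ltr0n//.
have [sz _] := sign_seq_count se sa.
have : (0 < count_mem e (e' :: a) + count_mem (- e) (e' :: a))%N by rewrite sz.
rewrite addn_gt0 => /orP[c0|c0].
  apply: ltr_pwDl; first by rewrite mulr_gt0 ?ltr0n.
  by rewrite mulr_ge0 ?ler0n ?subr_ge0 ?(ltW p_lt1).
apply: ltr_wpDl; first by rewrite mulr_ge0 ?ler0n ?(ltW p_gt0).
by rewrite mulr_gt0 ?ltr0n ?subr_gt0.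
Qed.

End path_weight.

(** * The law of the walk *)

Section erw_law.
Context d (Omega : measurableType d) (R : realType) (Pr : probability Omega R).
Context (p q : R) (X : nat -> {RV Pr >-> int}) (U : nat -> {RV Pr >-> nat})
  (eps : nat -> {RV Pr >-> bool}) (erwX : is_erw p q X U eps).
Local Notation choice := (erw_choice X U eps).

Fixpoint history n (w : Omega) : seq int :=
  if n is m.+1 then X m.+1 w :: history m w else [::].

Lemma size_history n w : size (history n w) = n.
Proof. by elim: n => //= n ->. Qed.

Lemma nth_history n i w : (i < n)%N -> nth 0 (history n w) i = X (n - i) w.
Proof.
elim: n i => // n IH [|i] /=; first by rewrite subn0.
by rewrite ltnS => /IH ->.
Qed.

Lemma walk_history n w : walk X w n = \sum_(x <- history n w) x.
Proof.
rewrite /walk; elim: n => [|n IH]; first by rewrite big_geq// big_nil.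
by rewrite big_nat_recr//= IH big_cons addrC.
Qed.

Lemma drop_history k m w : (k <= m)%N ->
  drop (m - k) (history m w) = history k w.
Proof.
move=> km; rewrite -{2}(subnK km); elim: (m - k)%N => //=.
by rewrite drop0.
Qed.

Lemma measurable_history n a : measurable [set w | history n w = a].
Proof.
elim: n a => [|n IH] [|e a].
- by rewrite (_ : mkset _ = setT)//; apply/seteqP; split.
- by rewrite (_ : mkset _ = set0)//; apply/seteqP; split.
- by rewrite (_ : mkset _ = set0)//; apply/seteqP; split.
rewrite (_ : mkset _ = X n.+1 @^-1` [set e] `&` [set w | history n w = a]).
  by apply: measurableI => //; exact: measurable_funPTI.
by apply/seteqP; split => w /= [-> ->].
Qed.

Definition choice_time (i : option (nat + nat)) : nat :=
  match i with None => 0 | Some (inl n) => n.+1 | Some (inr n) => n.+1 end.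

(** Events that fix finitely many of the random choices with index in [D]; the
    events to which the independence hypothesis applies. *)
Definition box (D : pred (option (nat + nat))) (B : set Omega) : Prop :=
  exists (J : seq (option (nat + nat))) (F : option (nat + nat) -> set Omega),
    [/\ uniq J, {subset J <= D}, forall i, i \in J -> choice i (F i)
      & B = \big[setI/setT]_(i <- J) F i].

Lemma box_sub D D' B : {subset D <= D'} -> box D B -> box D' B.
Proof.
move=> DD' [J [F [uJ JD JF BE]]]; exists J, F; split => //.
by move=> i /JD /DD'.
Qed.

Lemma box_setT D : box D setT.
Proof. by exists [::], (fun=> setT); split => //; rewrite big_nil. Qed.

Lemma measurable_choice i S : choice i S -> measurable S.
Proof.
by case: i => [[n|n]|] /= [B _ <-]; rewrite setTI; exact: measurable_funPTI.
Qed.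

Lemma choice_first e : choice None [set w | X 1%N w = e].
Proof. by exists [set e]; rewrite ?setTI. Qed.

Lemma choice_recall n k : choice (Some (inl n)) [set w | U n.+1 w = k].
Proof. by exists [set k]; rewrite ?setTI. Qed.

Lemma choice_sign n b : choice (Some (inr n)) [set w | eps n.+1 w = b].
Proof. by exists [set b]; rewrite ?setTI. Qed.

Lemma measurable_box D B : box D B -> measurable B.
Proof.
move=> [J [F [_ _ JF ->]]]; rewrite big_seq; apply: bigsetI_measurable => i iJ.
exact: measurable_choice (JF i iJ).
Qed.

Lemma box_cons D i S B : i \notin D -> choice i S -> box D B ->
  (box (predU1 i D) (S `&` B) /\ Pr (S `&` B) = Pr S * Pr B)%E.
Proof.
move=> iD iS [J [F [uJ JD JF BE]]].
have iJ : i \notin J by apply: contraNN iD => /JD.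
pose F' j := if j == i then S else F j.
have F'i : F' i = S by rewrite /F' eqxx.
have F'J j : j \in J -> F' j = F j.
  by rewrite /F'; case: eqP => // ->; rewrite (negbTE iJ).
have F'c j : j \in i :: J -> choice j (F' j).
  by rewrite inE => /predU1P[->|jJ]; rewrite ?F'i ?F'J//; exact: JF.
have BE' : \big[setI/setT]_(j <- i :: J) F' j = S `&` B.
  by rewrite big_cons F'i BE; congr (_ `&` _); exact: eq_big_seq.
have uiJ : uniq (i :: J) by rewrite /= iJ.
split.
  exists (i :: J), F'; split => //.
  move=> j; rewrite inE => /predU1P[->|/JD jD]; apply/orP; first by left.
  by right.
rewrite -BE' (erw_indep erwX uiJ F'c) big_cons F'i; congr (_ * _)%E.
rewrite BE (erw_indep erwX uJ JF).
by apply: eq_big_seq => j jJ; rewrite F'J.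
Qed.

Definition later m : pred (option (nat + nat)) := fun i => (m <= choice_time i)%N.

Lemma Pr_X1 e : Pr [set w | X 1%N w = e] = (first_weight q e)%:E.
Proof.
rewrite /first_weight; case: eqP => [->|e1]; first exact: erw_first_pos erwX.
case: eqP => [->|e2]; first exact: erw_first_neg erwX.
have mX z : measurable [set w | X 1%N w = z] by exact: (measurable_funPTI (X 1%N) (Y := [set z])).
rewrite (@probability_total _ _ _ Pr _ (X 1%N) [:: 1; -1])//; last first.
  rewrite !big_cons big_nil adde0 (erw_first_pos erwX) (erw_first_neg erwX).
  by rewrite -EFinD; congr EFin; ring.
have disj z : e <> z -> [set w | X 1%N w = e] `&` [set w | X 1%N w = z] = set0.
  by move=> ez; apply/seteqP; split => w //= [->].
by rewrite !big_cons big_nil !disj// !measure0 !adde0.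
Qed.

(** By induction on time.  The last step of a history is removed by splitting
    according to the last recalled time and the last sign: together with the
    shorter history they determine this step, and they join [B] as two further
    choices.  This is why [B] appears in the statement. *)
Lemma history_law n a B : size a = n.+1 -> box (later n.+1) B ->
  (Pr ([set w | history n.+1 w = a] `&` B) = (path_weight p q a)%:E * Pr B)%E.
Proof.
elim: n a B => [|n IH] [|e a] B // /eq_add_S sa bB.
  move: sa => /eqP /=; rewrite size_eq0 => /eqP ->.
  rewrite -Pr_X1 -(@box_cons (later 1) None [set w | X 1%N w = e] _ _ (choice_first e) bB).2//.
  by congr (Pr (_ `&` _)); apply/seteqP; split => w /= [->].
have {}sa : size a = n.+1 := sa.
set m := n.+1; have mB := measurable_box bB.
have mU k : measurable [set w | U m w = k] by exact: (measurable_funPTI (U m) (Y := [set k])).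
have meps b : measurable [set w | eps m w = b] by exact: (measurable_funPTI (eps m) (Y := [set b])).
have PrB : Pr B = (fine (Pr B))%:E by rewrite fineK// fin_num_measure.
have mH := measurable_history m.
set w0 := path_weight p q a.
(* Once k is recalled with sign b, the next step is known: the event is either
   impossible or amounts to a history that is one step shorter, together with
   two more choices. *)
have choose k (b : bool) : (1 <= k <= m)%N ->
    (Pr ([set w | history m.+1 w = e :: a] `&` B `&` [set w | U m w = k] `&`
        [set w | eps m w = b]) =
    ((nth 0 a (m - k) == (if b then e else - e))%:R *
      (w0 * (m%:R^-1 * (if b then p else 1 - p)) * fine (Pr B)))%:E)%E.
  move=> km; have /andP[k0 km'] := km.
  have Xk w : history m w = a -> X k w = nth 0 a (m - k).
    move=> <-; rewrite nth_history ?subKn//.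
    by rewrite -subn_gt0 subKn.
  have XS w : history m w = a -> U m w = k -> eps m w = b ->
      X m.+1 w = if b then nth 0 a (m - k) else - nth 0 a (m - k).
    by move=> Ha Uk eb; rewrite (erw_step erwX w (ltn0Sn n)) Uk eb Xk.
  have [ne|ne] := eqVneq; last first.
    rewrite mul0r (_ : _ `&` _ = set0) ?measure0//.
    apply/seteqP; split => w //= [[[[Xe Ha] _] Uk] eb].
    move: ne; rewrite (XS w Ha Uk eb) in Xe; rewrite -Xe.
    by case: (b); rewrite ?opprK eqxx.
  rewrite mul1r.
  have recallN : Some (inl n) \notin later m.+1 by rewrite unfold_in /later /= ltnn.
  have [bU PU] := box_cons recallN (choice_recall n k) bB.
  have signN : Some (inr n) \notin predU1 (Some (inl n)) (later m.+1).
    by rewrite unfold_in /= /later /= ltnn.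
  have [bE PE] := box_cons signN (choice_sign n b) bU.
  rewrite (_ : _ `&` _ = [set w | history m w = a] `&`
        ([set w | eps m w = b] `&` ([set w | U m w = k] `&` B))).
      rewrite IH//; last first.
        apply: box_sub bE => i; rewrite !inE => /predU1P[->|/predU1P[->|im]].
        + exact: leqnn.
        + exact: leqnn.
        + exact: (@ltnW _ _ im).
      rewrite PE PU (erw_recall erwX km) PrB.
      have -> : Pr [set w | eps m w = b] = (if b then p else 1 - p)%:E.
        by case: (b); [exact: (erw_repeat erwX)|exact: (erw_reverse erwX)].
      by rewrite -!EFinM; congr EFin; rewrite /w0; ring.
    apply/seteqP; split => w /=.
      by move=> [[[[Xe Ha] ?] ?] ?].
    move=> [Ha [eb [Uk ?]]]; do !split => //; congr (_ :: _) => //.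
    by rewrite (XS w Ha Uk eb) ne; case: (b); rewrite ?opprK.
have mE : measurable ([set w | history m.+1 w = e :: a] `&` B).
  by apply: measurableI => //; exact: measurable_history.
rewrite path_weight_cons; last by rewrite -size_eq0 sa.
rewrite (@probability_total _ _ _ Pr _ (U m) (index_iota 1 m.+1))//; last 2 first.
- exact: iota_uniq.
- under eq_big_seq => k.
    by rewrite mem_index_iota ltnS => km; rewrite (erw_recall erwX km); over.
  rewrite sumEFin sumr_const_nat subSS subn0 -[_ *+ m]mulr_natr.
  by rewrite mulVf// pnatr_eq0.
under eq_big_seq => k.
  rewrite mem_index_iota ltnS => km.
  rewrite (@probability_total _ _ _ Pr _ (eps m) [:: true; false])//; last 2 first.
  - by apply: measurableI.
  - rewrite !big_cons big_nil adde0 (erw_repeat erwX)// (erw_reverse erwX)//.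
    by rewrite -EFinD; congr EFin; ring.
  rewrite !big_cons big_nil adde0 !choose// -EFinD.
  over.
rewrite sumEFin PrB -EFinM; congr EFin.
have count z : \sum_(i <- index_iota 1 m.+1) (a`_(m - i) == z)%:R =
    (count_mem z a)%:R :> R.
  rewrite big_add1 /= big_nat_rev /= add0n -sum1_count natr_sum.
  rewrite [RHS](big_nth 0) sa [RHS]big_mkcond; apply: eq_big_nat => i /andP[_ im].
  by rewrite subnSK// subKn ?(ltnW im)//=; case: eqP.
rewrite big_split/= -!mulr_suml !count /step_weight sa -/m -/w0 /=.
by field; rewrite pnatr_eq0.
Qed.

Lemma history_prob n a : size a = n.+1 ->
  Pr [set w | history n.+1 w = a] = (path_weight p q a)%:E.
Proof.
move=> sa; have := history_law sa (box_setT (later n.+1)).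
by rewrite setIT probability_setT mule1.
Qed.

Lemma measurable_history_pred n (E : set (seq int)) :
  measurable [set w | E (history n w)].
Proof. exact: (measurable_countable_preimage E (measurable_history n)). Qed.

(** The weight of the next step depends on a list of signs only through its sum,
    so it is constant over all histories that lead to [x]. *)
Lemma history_markov n (E : set (seq int)) (x e : int) :
  (e == 1) || (e == -1) -> (forall a, E a -> \sum_(y <- a) y = x) ->
  (Pr ([set w | E (history n.+1 w)] `&` [set w | X n.+2 w = e]) =
  (1 / 2 + e%:~R * ((p - 1 / 2) * (x%:~R / n.+1%:R)))%:E *
  Pr [set w | E (history n.+1 w)])%E.
Proof.
move=> se Ex.
have mE : measurable [set w | E (history n.+1 w)].
  exact: measurable_history_pred.
apply: (probability_proportional (measurable_history n.+1)) => //.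
  by apply: measurableI => //; exact: (measurable_funPTI (X n.+2) (Y := [set e])).
move=> a; have [[sa Ea]|nE] := pselect (size a = n.+1 /\ E a); last first.
  have empty : [set w | E (history n.+1 w)] `&` [set w | history n.+1 w = a] = set0.
    apply/seteqP; split => w //= [Eh ha]; apply: nE; rewrite -ha.
    by split => //; exact: (size_history n.+1 w).
  by rewrite setIAC empty set0I measure0 mule0.
have -> : [set w | E (history n.+1 w)] `&` [set w | X n.+2 w = e] `&`
    [set w | history n.+1 w = a] = [set w | history n.+2 w = e :: a].
  apply/seteqP; split => w /=; first by move=> [[_ ->] ->].
  by move=> [-> ha]; rewrite ha.
have -> : [set w | E (history n.+1 w)] `&` [set w | history n.+1 w = a] =
    [set w | history n.+1 w = a].
  by apply/seteqP; split => w /= [] // ha; rewrite ha.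
rewrite !history_prob//; last by rewrite /= sa.
rewrite path_weight_cons; last by rewrite -size_eq0 sa.
have [->|w0] := eqVneq (path_weight p q a) 0; first by rewrite mul0r mule0.
rewrite step_weight_sign//; last 2 first.
- exact: sign_seq_weight w0.
- by rewrite -size_eq0 sa.
by rewrite (Ex _ Ea) sa EFinM muleC.
Qed.

(** The future step depends on the past only through the present position.
    The event [A] may constrain the whole path up to time [n.+1]: taking all
    paths gives the transition probabilities of the walk, and taking the paths
    that have avoided the origin gives those of the killed walk. *)
Lemma walk_markov n (x e : int) (A : set path_space) :
  (forall s s', (forall k, (k <= n.+1)%N -> s k = s' k) -> A s -> A s') ->
  (e == 1) || (e == -1) ->
  (Pr [set w | [/\ A (walk X w), walk X w n.+1 = x & walk X w n.+2 = (x + e)%R]] =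
  (1 / 2 + e%:~R * ((p - 1 / 2) * (x%:~R / n.+1%:R)))%:E *
  Pr [set w | A (walk X w) /\ walk X w n.+1 = x])%E.
Proof.
move=> Apast se.
(* The path up to time n.+1 is rebuilt from the list of steps; latest steps
   come first, so the earliest k steps are what is left after dropping. *)
pose past a : path_space := fun k => \sum_(y <- drop (n.+1 - k) a) y.
have pastE k w : (k <= n.+1)%N -> past (history n.+1 w) k = walk X w k.
  by move=> kn; rewrite /past drop_history// -walk_history.
have ApastE w : A (past (history n.+1 w)) = A (walk X w).
  by apply: propext; split; apply: Apast => k kn; rewrite pastE.
have := @history_markov n [set a | A (past a) /\ past a n.+1 = x] x e se.
have -> : [set w | [set a | A (past a) /\ past a n.+1 = x] (history n.+1 w)] =
    [set w | A (walk X w) /\ walk X w n.+1 = x].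
  by apply/seteqP; split => w /=; rewrite ApastE pastE.
move=> <-; last by move=> a [_]; rewrite /past subnn drop0.
congr (Pr _); apply/seteqP; split => w /=.
  move=> [Aw Sx Sxe]; do !split => //.
  by apply: (addrI x); rewrite -Sxe -Sx /walk [RHS]big_nat_recr.
by move=> [[Aw Sx] Xe]; split => //; rewrite -Sx -Xe /walk big_nat_recr.
Qed.

Hypotheses (p_gt0 : 0 < p) (p_lt1 : p < 1) (q_gt0 : 0 < q) (q_lt1 : q < 1).

Lemma sign_seq_reachable n x : (0 < Pr [set w | walk X w n.+1 = x])%E ->
  exists a, [/\ sign_seq a, size a = n.+1 & \sum_(y <- a) y = x].
Proof.
move=> Sx; apply: contrapT => noseq; move: Sx; apply/negP; rewrite -leNgt.
have mS : measurable [set w | walk X w n.+1 = x].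
  under eq_set do rewrite walk_history.
  exact: (@measurable_history_pred n.+1 [set a | \sum_(y <- a) y = x]).
rewrite (_ : Pr _ = 0%E)//.
rewrite (probability_proportional (c := 0) (B := set0) (measurable_history n.+1)) ?mul0e//.
move=> a; rewrite mul0e.
have [[sa Ea]|nE] := pselect (size a = n.+1 /\ \sum_(y <- a) y = x); last first.
  rewrite (_ : _ `&` _ = set0) ?measure0//.
  apply/seteqP; split => w //=; rewrite walk_history => -[Eh ha]; apply: nE.
  by rewrite -ha; split => //; exact: (size_history n.+1 w).
apply/eqP; rewrite -measure_le0.
apply: (@le_trans _ _ (Pr [set w | history n.+1 w = a])).
  apply: le_measure; rewrite ?inE//; last exact: measurable_history.
  by apply: measurableI => //; exact: measurable_history.
rewrite history_prob// lee_fin; apply: contrapT => w0.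
by apply: noseq; exists a; split => //; apply: (@sign_seq_weight _ p q); apply/eqP => w00; apply: w0; rewrite w00.
Qed.

(** Taking first all the steps in the direction of [x] and then all the others
    leads to [x] without returning to 0. *)
Lemma walk_avoids_gt0 n (x : int) : x != 0 ->
  (0 < Pr [set w | walk X w n.+1 = x])%E ->
  (0 < Pr [set w | avoids n.+1 (walk X w) /\ walk X w n.+1 = x])%E.
Proof.
move=> x0 /sign_seq_reachable[a [sgna sa sumx]].
pose s := Num.sg x.
have ss : (s == 1) || (s == -1) by rewrite /s; case: sgrP x0 => //; rewrite eqxx.
have [] := sign_seq_count ss sgna; rewrite sumx.
set u := count_mem s a; set v := count_mem (- s) a; rewrite sa => uv uvx.
have vu : (v < u)%N.
  have : 0 < u%:Z - v%:Z by rewrite uvx /s -normrEsg normr_gt0.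
  by lia.
(* Latest steps first: the v steps away from x come last in time. *)
pose a' := nseq v (- s) ++ nseq u s.
have sum_nseq k (c : int) : \sum_(y <- nseq k c) y = c * k%:Z.
  by rewrite big_nseq iter_addr_0 -mulr_natr natz.
have sum_drop j : (j < u + v)%N -> \sum_(y <- drop j a') y != 0.
  move=> juv; rewrite /a' drop_cat size_nseq; case: ltnP => jv.
    rewrite drop_nseq big_cat/= !sum_nseq.
    by case/orP: ss => /eqP ->; apply/eqP; lia.
  rewrite drop_nseq sum_nseq.
  by case/orP: ss => /eqP ->; apply/eqP; lia.
have a'n : size a' = n.+1 by rewrite size_cat !size_nseq addnC.
have sum_a' : \sum_(y <- a') y = x.
  rewrite big_cat/= !sum_nseq mulNr addrC -mulrBr uvx mulrA.
  by rewrite -expr2; case/orP: ss => /eqP ->; rewrite ?sqrrN ?expr1n mul1r.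
apply: (@lt_le_trans _ _ (Pr [set w | history n.+1 w = a'])).
  rewrite history_prob// lte_fin path_weight_gt0// /sign_seq all_cat !all_nseq /=.
  by case/orP: ss => /eqP ->; rewrite ?eqxx ?orbT.
have pastE k w : (k <= n.+1)%N -> history n.+1 w = a' ->
    walk X w k = \sum_(y <- drop (n.+1 - k) a') y.
  by move=> kn <-; rewrite drop_history// walk_history.
apply: le_measure; rewrite ?inE//.
- exact: measurable_history.
- have -> : [set w | avoids n.+1 (walk X w) /\ walk X w n.+1 = x] =
      walk X @^-1` ([set s | avoids n.+1 s] `&` [set s | s n.+1 = x]) by [].
  apply: measurable_funPTI; apply: measurableI; first exact: measurable_avoids.
  exact: (measurable_coordinate n.+1 [set x]).
move=> w /= ha; split; last by rewrite (pastE _ _ (leqnn _) ha) subnn drop0.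
apply/allP => k; rewrite mem_iota => /andP[k0 kn].
rewrite (pastE k w _ ha)// sum_drop// uv.
by rewrite -subn_gt0 subKn.
Qed.

End erw_law.

(** * Transition probabilities of the conditioned walk *)

Theorem theorem1p4 (R : realType) (p q : R)
    (p_gt0 : 0 < p) (p_le : p <= 3 / 4) (q_gt0 : 0 < q) (q_lt1 : q < 1)
    (d : measure_display) (Omega : measurableType d) (Pr : probability Omega R)
    (X : nat -> {RV Pr >-> int}) (U : nat -> {RV Pr >-> nat})
    (eps : nat -> {RV Pr >-> bool}) (erwX : is_erw p q X U eps)
    (Q : probability path_space R)
    (cerwQ : is_cerw p (distribution Pr (walk X)) Q) :
  let P := distribution Pr (walk X) in
  [/\ Q [set s : path_space | s 0%N = 0] = 1%E,
      (forall e : int, e = 1 \/ e = -1 ->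
         Q [set s : path_space | s 1%N = e] =
         P [set s : path_space | s 1%N = e])
    & (forall (m : nat) (x e : int), (1 <= m)%N -> x != 0 -> e = 1 \/ e = -1 ->
         (0 < P [set s : path_space | s m = x])%E ->
         let c := m%:R / (m%:R + 2 * p - 1) * (`|x + e|%:~R / `|x|%:~R) : R in
         cond_prob Q [set s | s m.+1 = x + e] [set s | s m = x] =
           c * cond_prob P [set s | s m.+1 = x + e] [set s | s m = x] /\
         c * cond_prob P [set s | s m.+1 = x + e] [set s | s m = x] =
           c * (1 / 2 + e%:~R * ((p - 1 / 2) * (x%:~R / m%:R))))].
Proof.
have p_lt1 : p < 1 by lra.
move=> P.
have a1 : erw_a p 1 != 0 by rewrite gt_eqF ?erw_a_gt0.
have h00 : erw_h p 0 0 = erw_a p 1 by [].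
have mwalk (A : set path_space) : P A = Pr (walk X @^-1` A) by [].
have QE m (x : int) (A : set path_space) : path_sigma m A ->
    A `<=` [set s | s m = x] -> 0 <= erw_h p m x / erw_a p 1 ->
    (Q A = (erw_h p m x / erw_a p 1)%:E * P (A `&` [set s | avoids m s]))%E.
  exact: (cerwE cerwQ).
have sigma_at m k (y : int) : (k <= m)%N -> path_sigma m [set s | s k = y].
  by move=> km; exact: (path_sigma_coordinate [set y] km).
split.
- have := @QE 0%N 0 [set s | s 0%N = 0].
  rewrite h00 divff// mul1e => -> //; last exact: sigma_at.
  rewrite mwalk (_ : _ @^-1` _ = setT) ?probability_setT//.
  by apply/seteqP; split => w //= _; split => //; rewrite /walk big_geq.
- move=> e se.
  have e1 : `|e| = 1 by case: se => ->.
  have := @QE 1%N e [set s | s 1%N = e].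
  rewrite /erw_h /= e1 mulr1 divff// mul1e => -> //; last exact: sigma_at.
  congr (P _); apply/seteqP; split => s /=; first by case.
  move=> se1; split => //.
  by rewrite /avoids /= se1; case: se => ->.
move=> [//|n] x e _ x0 se Sx c.
set m := n.+1 in Sx c *.
set t := 1 / 2 + _.
have sgn_e : (e == 1) || (e == -1) by case: se => ->.
have mS k y : measurable [set s : path_space | s k = y].
  exact: (measurable_coordinate k [set y]).
pose A := [set s : path_space | s m.+1 = x + e].
pose B := [set s : path_space | s m = x].
pose V := [set s : path_space | avoids m s].
have mV : measurable V by exact: measurable_avoids.
(* The same factor t appears with and without killing at 0. *)
have PAB : P (A `&` B) = (t%:E * P B)%E.
  have := walk_markov erwX (n := n) x (A := setT) (fun s s' _ => id) sgn_e.
  rewrite -/m -/t !mwalk => E.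
  rewrite (_ : walk X @^-1` B = [set w | setT (walk X w) /\ walk X w m = x]).
    by rewrite -E; congr (Pr _); apply/seteqP; split => w [] // _.
  by apply/seteqP; split => w // [].
have PABV : P (A `&` B `&` V) = (t%:E * P (B `&` V))%E.
  have := walk_markov erwX (n := n) x (A := V) (@eq_avoids m) sgn_e.
  rewrite -/m -/t !mwalk => E.
  rewrite (_ : walk X @^-1` (B `&` V) = [set w | V (walk X w) /\ walk X w m = x]).
    by rewrite -E; congr (Pr _); apply/seteqP; split => w [] // [].
  by apply/seteqP; split => w [].
have [b Pb] : exists b, P B = b%:E.
  exists (fine (P B)); rewrite fineK// mwalk fin_num_measure//.
  by apply: measurable_funPTI; exact: mS.
have [g Pg] : exists g, P (B `&` V) = g%:E.
  exists (fine (P (B `&` V))); rewrite fineK// mwalk fin_num_measure//.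
  by apply: measurable_funPTI; apply: measurableI => //; exact: mS.
have b_gt0 : 0 < b by rewrite -lte_fin -Pb.
have g_gt0 : 0 < g.
  rewrite -lte_fin -Pg mwalk.
  have := walk_avoids_gt0 erwX p_gt0 p_lt1 q_gt0 q_lt1 x0 Sx.
  by congr (_ < Pr _)%E; apply/seteqP; split => w [].
have am_gt0 : 0 < erw_a p m by exact: erw_a_gt0.
have h_ge0 k y : 0 <= erw_h p k.+1 y / erw_a p 1.
  apply: divr_ge0; last exact/ltW/erw_a_gt0.
  by apply: mulr_ge0; [exact/ltW/erw_a_gt0 | rewrite ler0z].
have QB : Q B = (erw_h p m x / erw_a p 1 * g)%:E.
  have := QE m x B (sigma_at m m x (leqnn m)) (fun s Bs => Bs) (h_ge0 n x).
  by rewrite -/V Pg -EFinM.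
have QAB : Q (A `&` B) = (erw_h p m.+1 (x + e) / erw_a p 1 * (t * g))%:E.
  have sAB : path_sigma m.+1 (A `&` B) by apply: path_sigmaI; exact: sigma_at.
  rewrite (QE m.+1 (x + e) (A `&` B) sAB (fun s ABs => ABs.1) (h_ge0 m (x + e))).
  have [xe0|xe0] := eqVneq (x + e) 0.
    (* Here avoiding 0 up to time m.+1 is impossible, and h vanishes as well. *)
    by rewrite /erw_h xe0 normr0 mulr0 !mul0r mul0e.
  rewrite [RHS]EFinM; congr (_ * _)%E; rewrite EFinM -Pg -PABV; congr (P _).
  apply/seteqP; split => s /=; rewrite avoidsS.
    by move=> [AB /andP[]].
  by move=> [[As Bs] ->]; split => //; rewrite As.
have cP : cond_prob P A B = t.
  by rewrite /cond_prob PAB Pb -EFinM /= mulfK// gt_eqF.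
rewrite -/A -/B cP; split => //.
rewrite /cond_prob QAB QB /= /erw_h /= erw_aS// /c.
have mp_gt0 : 0 < m%:R + 2 * p - 1.
  have : 1 <= m%:R :> R by rewrite ler1n.
  by lra.
move: t {PAB PABV QAB cP} => t.
field.
by rewrite pnatr_eq0 absz_eq0 x0 a1 !gt_eqF.
Qed.
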